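(* Let $\tau$ be a cardinal and let $S=\{X_\alpha,p^\beta_\alpha,\alpha<\beta<\tau\}$ be an almost continuous inverse system with nearly open bonding maps such that $X$ is the almost limit of $S$, $X=\mathrm{a}\text{-}\varprojlim S$. Then the family of all open subsets of $X$ having a finite rank is a base for $X$.
   Context: All topological spaces are Tychonoff and all maps are continuous. The index set of $S$ is the set of ordinals less than $\tau$, with bonding maps $p^\beta_\alpha:X_\beta\to X_\alpha$. Nearly open: a map $f:X\to Y$ is nearly open if $f(U)\subset\mathrm{Int}\,\overline{f(U)}$ for every open $U\subset X$. Almost limit: $X=\mathrm{a}\text{-}\varprojlim S$ means that $X$ is embedded in $\varprojlim S$ and $p_\alpha(X)=X_\alpha$ for each $\alpha$, where $p_\alpha:\varprojlim S\to X_\alpha$ is the $\alpha$-th limit projection; below, $p_\alpha$ also denotes its restriction $X\to X_\alpha$. Almost continuous: $S$ is almost continuous if for every limit ordinal $\gamma<\tau$ the space $X_\gamma$ is (via the maps $p^\gamma_\alpha$, $\alpha<\gamma$) the almost limit of the inverse system $S_\gamma=\{X_\alpha,p^\beta_\alpha,\alpha<\beta<\gamma\}$. Rank: for $H\subset X$, the rank of $H$ is the set $$q(H)=\{\alpha:\ \mathrm{Int}\big((p^{\alpha+1}_\alpha)^{-1}(\overline{p_\alpha(H)})\setminus\overline{p_{\alpha+1}(H)}\big)\neq\varnothing\},$$ where closures are taken in $X_\alpha$ and $X_{\alpha+1}$ respectively and the interior in $X_{\alpha+1}$. $H$ has a finite rank if $q(H)$ is a finite set. *)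

(* Defs.v *)
From HB Require Import structures.
From mathcomp Require Import all_boot all_order.
From mathcomp Require Import boolp classical_sets cardinality wochoice.
From mathcomp Require Import topology urysohn.

Set Implicit Arguments.
Unset Strict Implicit.
Unset Printing Implicit Defensive.

Import Order.TTheory.
Local Open Scope order_scope.
Local Open Scope classical_set_scope.
Local Open Scope card_scope.

(* A cardinal tau is an initial ordinal: a well-ordered type [I] (the ordinals
   below tau) that is not equipotent to any of its proper initial segments.
   Finite cardinals, including 0, are allowed. *)
Definition is_cardinal d (I : orderType d) : Prop :=
  well_order (<=%O : rel I) /\
  forall a : I, ~ ([set: I] #= [set b : I | b < a]).

Definition tychonoff_space (T : topologicalType) : Prop :=
  accessible_space T /\ completely_regular_space T.

Definition nearly_open (T U : topologicalType) (f : T -> U) : Prop :=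
  forall A : set T, open A -> f @` A `<=` (closure (f @` A))°.

(* Homeomorphism onto the image, the latter with the subspace topology. *)
Definition embedding (T U : topologicalType) (f : T -> U) : Prop :=
  [/\ injective f, continuous f &
      forall A : set T, open A -> open (f @` A : set (subspace (range f)))].

(* [bond ab : X_b -> X_a] for [ab : a < b]; as [lt] is boolean, [bond ab] does
   not depend on the choice of [ab]. *)
Record inverse_system (J : choiceType) (lt : rel J) := InverseSystem {
  space :> J -> topologicalType ;
  bond : forall a b : J, lt a b -> space b -> space a ;
  bond_continuous : forall (a b : J) (ab : lt a b), continuous (bond ab) ;
  bond_comp : forall (a b c : J) (ab : lt a b) (bc : lt b c) (ac : lt a c)
      (x : space c), bond ab (bond bc x) = bond ac x }.

Definition inverse_limit (J : choiceType) (lt : rel J)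
    (S : inverse_system lt) : set (prod_topology (space S)) :=
  [set x | forall (a b : J) (ab : lt a b), bond ab (x b) = x a].

(* The embedding of [X] into the limit is given by its coordinates [p a], which
   are then the restrictions to [X] of the limit projections. *)
Definition almost_limit (J : choiceType) (lt : rel J) (S : inverse_system lt)
    (X : topologicalType) (p : forall a : J, X -> S a) : Prop :=
  [/\ embedding (join_product p : X -> prod_topology (space S)),
      range (join_product p) `<=` @inverse_limit J lt S &
      forall a : J, range (p a) = [set: S a]].

Section WellOrderedSystems.
Context {d : Order.disp_t} {I : orderType d}.
Implicit Types S : inverse_system (<%O : rel I).

Definition segment (g : I) : choiceType := {a : I | a < g}.

Definition segment_lt (g : I) : rel (segment g) :=
  fun a b => sval a < sval b.

Definition initial_system S (g : I) : inverse_system (@segment_lt g) :=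
  @InverseSystem (segment g) (@segment_lt g)
    (fun a => S (sval a))
    (fun a b ab => @bond I <%O S (sval a) (sval b) ab)
    (fun a b ab => @bond_continuous I <%O S (sval a) (sval b) ab)
    (fun a b c ab bc ac =>
       @bond_comp I <%O S (sval a) (sval b) (sval c) ab bc ac).

(* The least index is not a limit ordinal. *)
Definition limit_index (g : I) : Prop :=
  (exists a : I, a < g) /\ forall a : I, a < g -> exists2 b : I, a < b & b < g.

Definition almost_continuous S : Prop :=
  forall g : I, limit_index g ->
    @almost_limit (segment g) (@segment_lt g) (initial_system S g) (S g)
      (fun a => @bond I <%O S (sval a) g (svalP a)).

(* [b] is the successor of [a].  An index without a successor (the last one, when tau is finite and nonzero)
   is not in the rank. *)
Definition rank S (X : topologicalType) (p : forall a : I, X -> S a)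
    (H : set X) : set I :=
  [set a | exists (b : I) (ab : a < b),
    (forall c : I, a < c -> b <= c) /\
    (((bond ab : S b -> S a) @^-1` closure (p a @` H))
       `\` closure (p b @` H))° !=set0].

End WellOrderedSystems.

(* Main.v *)
Require Import Defs.
From HB Require Import structures.
From mathcomp Require Import all_boot all_order.
From mathcomp Require Import boolp classical_sets cardinality wochoice.
From mathcomp Require Import topology urysohn.

(** The sets [p a @^-1` U], with [U] open in [S a], form a base of [X]: the
    indices are totally ordered, so finitely many coordinates can be pulled back
    to the largest of them ([almost_limit_base]).  The rank of such a set lies
    below [a], because the preimage of the closure of an open set under a nearly
    open map is in the closure of its preimage ([rank_preimage_open]).  It thus
    suffices to show, by transfinite induction on [a], that the open sets [V] of
    [S a] for which [p a @^-1` V] has finite rank form a base of [S a]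
    ([finite_rank_base]).

    At the least index the rank is empty.  At a limit index [S a] is an almost
    limit, so its basic open sets are preimages of open sets of some [S c],
    [c < a], and pulling these back does not change their preimage in [X].  At a
    successor of [b], with bonding map [f : S a -> S b] and an open [U] around
    [x], near openness puts [f x] in the interior of the closure of [f @` U].
    By induction that interior contains an open [V] around [f x] of finite rank.
    The open set [U `&` f @^-1` V] has image [f @` U `&` V], which is dense in
    [V].  Below [b] the rank depends only on the closure of the image in [S b]
    ([rank_below]), so there [U `&` f @^-1` V] has the same rank as [V]; above,
    it can only gain the index [b]. *)

Set Implicit Arguments.
Unset Strict Implicit.
Unset Printing Implicit Defensive.

Import Order.TTheory.
Local Open Scope classical_set_scope.

Lemma continuous_image_closure (T U : topologicalType) (f : T -> U)
    (A : set T) :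
  continuous f -> f @` closure A `<=` closure (f @` A).
Proof.
move=> fc _ [x clAx <-] B /fc /clAx [y [Ay By]].
by exists (f y); split=> //; exists y.
Qed.

(** If [f x] is in the closure of [V] and [W] is an open neighborhood of [x],
    then the interior of the closure of [f @` W] is a neighborhood of [f x] and
    so meets [V]; hence [f @` W] itself meets the open set [V]. *)
Lemma closure_preimage_nearly_open (T U : topologicalType) (f : T -> U)
    (V : set U) :
  nearly_open f -> open V -> f @^-1` closure V `<=` closure (f @^-1` V).
Proof.
move=> fno oV x clVfx B; rewrite nbhsE => -[W [oW Wx] WB].
have fWx : (closure (f @` W))° (f x) by apply: fno => //; exists x.
have [y [Vy /interior_subset clWy]] :=
  clVfx _ (open_nbhs_nbhs (conj (open_interior _) fWx)).
have [_ [[w Ww <-] Vw]] := clWy _ (open_nbhs_nbhs (conj oV Vy)).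
by exists w; split=> //; exact: WB.
Qed.

Lemma closure_denseI (T : topologicalType) (A V : set T) :
  open V -> V `<=` closure A -> closure (A `&` V) = closure V.
Proof.
move=> oV VA; apply/seteqP; split; first by apply: closureS; exact: subIsetr.
move=> x clVx B; rewrite nbhsE => -[W [oW Wx] WB].
have [y [Vy Wy]] := clVx _ (open_nbhs_nbhs (conj oW Wx)).
have [z [Az [Vz Wz]]] :=
  VA y Vy (V `&` W) (open_nbhs_nbhs (conj (openI oV oW) (conj Vy Wy))).
by exists z; split=> //; exact: WB.
Qed.

Section AlmostLimit.
Context (J : choiceType) (lt : rel J) (S : inverse_system lt).
Context (X : topologicalType) (p : forall a : J, X -> S a).
Hypothesis limp : almost_limit p.

Lemma almost_limit_continuous a : continuous (p a).
Proof.
have [[_ jc _] _ _] := limp => x.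
have pc : {for join_product p x,
    continuous (fun y : prod_topology (space S) => y a)}.
  exact: proj_continuous.
exact: (@continuous_comp _ _ _
  (join_product p : X -> prod_topology (space S)) _ x (jc x) pc).
Qed.

Lemma almost_limit_bond a b (ab : lt a b) x : bond ab (p b x) = p a x.
Proof. by have [_ /(_ (join_product p x)) + _] := limp; apply; exists x. Qed.

Lemma almost_limit_surj a (y : S a) : exists x, p a x = y.
Proof.
have [_ _ /(_ a) pT] := limp; have : [set: S a] y by [].
by rewrite -pT => -[x _ <-]; exists x.
Qed.

(** By totality the sets [p a @^-1` V] around [x] are closed under finite
    intersections, so they generate a filter on [X].  Its image converges to
    [join_product p x], as convergence in a product is coordinatewise; since [p]
    is an embedding, the filter then contains every neighborhood of [x].  The
    index [j0] matters: over an empty [J] there is no coordinate at all. *)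
Lemma almost_limit_base (j0 : J)
    (lt_total : forall a b, [\/ a = b, lt a b | lt b a]) (U : set X) (x : X) :
    open U -> U x ->
  exists (a : J) (V : set (S a)), [/\ open V, V (p a x) & p a @^-1` V `<=` U].
Proof.
move=> oU Ux.
pose D := [set A : set X | exists (a : J) (V : set (S a)),
  [/\ open V, V (p a x) & p a @^-1` V = A]].
pose F := filter_from D id.
have pull a b (ab : lt a b) (V : set (S a)) (W : set (S b)) :
    open V -> V (p a x) -> open W -> W (p b x) ->
    D (p a @^-1` V `&` p b @^-1` W).
  move=> oV Vx oW Wx; exists b, (bond ab @^-1` V `&` W); split.
  - by apply: openI => //; apply: open_comp => // y _; exact: bond_continuous.
  - by split=> //=; rewrite almost_limit_bond.
  - by apply/seteqP; split=> y /=; rewrite almost_limit_bond.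
have FF : Filter F.
  apply: filter_from_filter.
    by exists setT, j0, setT; split=> //; exact: openT.
  move=> _ _ [a [V [oV Vx <-]]] [b [W [oW Wx <-]]].
  have [abE|ab|ba] := lt_total a b.
  - subst b; exists (p a @^-1` (V `&` W)) => //.
    by exists a, (V `&` W); split=> //; exact: openI.
  - by exists (p a @^-1` V `&` p b @^-1` W) => //; exact: (pull _ _ ab).
  - rewrite setIC; exists (p b @^-1` W `&` p a @^-1` V) => //.
    exact: (pull _ _ ba).
have Fx : join_product p @ F --> (join_product p x : prod_topology (space S)).
  apply/cvg_sup => a A /=.
  rewrite (@nbhsE (initial_topology (fun f : forall i : J, S i => f a))).
  move=> [_ [[V oV <-] Vx] VA]; exists (p a @^-1` V); first by exists a, V.
  by move=> y Vy; apply: VA.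
have [[jinj _ jopen] _ _] := limp.
have /open_subspaceP[W oW WU] := jopen _ oU.
have Wx : W (join_product p x).
  suff : (W `&` range (join_product p)) (join_product p x) by case.
  by rewrite WU; split; exists x.
have [_ [a [V [oV Vx <-]]] VW] := Fx W (open_nbhs_nbhs (conj oW Wx)).
exists a, V; split=> // y /VW Wy.
have : (W `&` range (join_product p)) (join_product p y).
  by split=> //; exists y.
by rewrite WU => -[[z Uz /jinj <-]].
Qed.

End AlmostLimit.

Section Rank.
Context (d : Order.disp_t) (I : orderType d).
Context (S : @inverse_system I (fun a b : I => (a < b)%O)).
Context (X : topologicalType) (p : forall a : I, X -> S a).
Hypothesis limp : almost_limit p.

(** Projections at [c] factor through [p b] by a continuous map, which
    preserves equality of closures of images. *)
Lemma closure_image_below b (H K : set X) :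
    closure (p b @` H) = closure (p b @` K) ->
  forall c, (c <= b)%O -> closure (p c @` H) = closure (p c @` K).
Proof.
move=> HK c; rewrite le_eqVlt => /predU1P[->//|cb].
have sub (A B : set X) : closure (p b @` A) = closure (p b @` B) ->
    closure (p c @` A) `<=` closure (p c @` B).
  move=> AB; rewrite [X in _ `<=` X](closure_id _).1; last first.
    exact: closed_closure.
  apply: closureS => _ [x Ax <-]; rewrite -(almost_limit_bond limp cb).
  have : closure (p b @` B) (p b x).
    by rewrite -AB; apply: subset_closure; exists x.
  move=> /(imageP (bond cb)).
  move=> /(continuous_image_closure (@bond_continuous _ _ S _ _ cb)).
  apply: closureS => _ [_ [y By <-] <-]; exists y => //.
  by rewrite almost_limit_bond.
by apply/seteqP; split; exact: sub.
Qed.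

(** Whether [c] is in the rank is decided by closures of images at [c] and its
    successor, and both indices are at most [b] when [c < b]. *)
Lemma rank_below b (H K : set X) :
    closure (p b @` H) = closure (p b @` K) ->
  forall c, (c < b)%O -> rank p H c -> rank p K c.
Proof.
move=> HK c cb [c' [cc' [minc' ne]]]; exists c', cc'; split=> //.
rewrite -(closure_image_below HK (ltW cb)).
by rewrite -(closure_image_below HK (minc' _ cb)).
Qed.

Hypothesis bond_nearly_open : forall (a b : I) (ab : (a < b)%O),
  nearly_open (@bond _ _ S a b ab).

(** For [a <= c], the set [p a @^-1` U] is also the preimage of an open [W] of
    [S c], and near openness of the bonding map from the successor of [c] leaves
    nothing of the preimage of the closure of [W] outside the closure of the
    preimage of [W]. *)
Lemma rank_preimage_open a (U : set (S a)) :
  open U -> rank p (p a @^-1` U) `<=` [set c | (c < a)%O].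
Proof.
move=> oU c [b [cb [_ [z /interior_subset [/= clc nclb]]]]].
rewrite ltNge; apply/negP => ac; apply: nclb.
have [W [oW UE]] : exists W : set (S c), open W /\ p a @^-1` U = p c @^-1` W.
  move: ac; rewrite le_eqVlt => /predU1P[ac|ac]; first by subst c; exists U.
  exists (bond ac @^-1` U); split.
    by apply: open_comp => // y _; exact: bond_continuous.
  by apply/seteqP; split=> y /=; rewrite almost_limit_bond.
rewrite UE in clc *.
have : closure W (bond cb z) by apply: closureS clc => _ [y Wy <-].
move=> /(closure_preimage_nearly_open (@bond_nearly_open _ _ cb) oW).
apply: closureS => y /= Wy; have [x xy] := almost_limit_surj limp y.
by exists x => //=; rewrite -(almost_limit_bond limp cb) xy.
Qed.

Hypothesis contS : almost_continuous S.
Hypothesis woI : well_order (<=%O : rel I).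

Lemma well_order_induction (P : I -> Prop) :
  (forall a, (forall b, (b < a)%O -> P b) -> P a) -> forall a, P a.
Proof.
move=> step a; apply: contrapT => nPa.
have [|m [[/asboolP nPm minm] _]] := woI (A := [pred b | `[< ~ P b >]]).
  by exists a; apply/asboolP.
apply: nPm; apply: step => b bm; apply: contrapT => nPb.
by have := minm b (asboolT nPb); rewrite leNgt bm.
Qed.

(** Ranks are computed in the whole system, through [p], and not in the initial
    system below [a]: the preimage in [X] of a set pulled back along a bonding
    map is then unchanged, which makes the limit step immediate. *)
Lemma finite_rank_base a (U : set (S a)) (x : S a) : open U -> U x ->
  exists V : set (S a),
    [/\ open V, V x, V `<=` U & finite_set (rank p (p a @^-1` V))].
Proof.
move: a U x; apply: well_order_induction => a IH U x oU Ux.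
have [[b ba]|least] := pselect (exists b, (b < a)%O); last first.
  (* The rank lies below the least index, so it is empty. *)
  exists U; split=> //; rewrite (_ : rank _ _ = set0)//.
  apply/seteqP; split=> // c /(rank_preimage_open oU) ca.
  by case: least; exists c.
have [lima|nlima] := pselect (limit_index a).
  have tot (c e : segment a) : [\/ c = e, segment_lt c e | segment_lt e c].
    rewrite /segment_lt; have [ce|ec|/val_inj ce] := ltgtP (sval c) (sval e).
    - exact: Or32.
    - exact: Or33.
    - exact: Or31.
  have [i [V [oV Vx VU]]] :=
    almost_limit_base (contS lima) (exist _ b ba : segment a) tot oU Ux.
  have [W [oW Wx WV fW]] := IH (sval i) (svalP i) V _ oV Vx.
  exists (bond (svalP i) @^-1` W); split=> //.
  - by apply: open_comp => // y _; exact: bond_continuous.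
  - by move=> y Wy; apply: VU; exact: WV.
  - rewrite (_ : _ @^-1` _ = p (sval i) @^-1` W)//.
    by apply/seteqP; split=> y /=; rewrite almost_limit_bond.
(* Otherwise [a] has an immediate predecessor, called [b] again. *)
have {b ba} [b ba bmax] :
    exists2 b, (b < a)%O & forall c, (c < a)%O -> (c <= b)%O.
  apply: contrapT => nmax; apply: nlima; split; first by exists b.
  move=> c ca; apply: contrapT => nc; apply: nmax; exists c => // e ea.
  by rewrite leNgt; apply/negP => ce; apply: nc; exists e.
pose f : S a -> S b := bond ba.
have fc : continuous f by exact: bond_continuous.
have fp y : f (p a y) = p b y by exact: almost_limit_bond.
have [] := IH b ba (closure (f @` U))° (f x) (open_interior _).
  by apply: bond_nearly_open => //; exists x.
move=> V [oV Vx VU fV].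
have oW : open (U `&` f @^-1` V).
  by apply: openI => //; apply: open_comp => // y _; exact: fc.
exists (U `&` f @^-1` V); split=> //.
apply: (@sub_finite_set _ _ (b |` rank p (p b @^-1` V))); last first.
  by rewrite finite_setU; split=> //; exact: finite_set1.
move=> c rc; have /bmax := rank_preimage_open oW rc.
rewrite le_eqVlt => /predU1P[->|cb]; [by left|right].
apply: rank_below cb rc.
have -> : p b @` (p b @^-1` V) = V.
  apply/seteqP; split=> [_ [y Vy <-]//|y Vy].
  by have [z zy] := almost_limit_surj limp y; exists z => //=; rewrite zy.
rewrite -(closure_denseI oV (subset_trans VU (@interior_subset _ _))).
congr closure; apply/seteqP; split=> [_ [y [Uy Vy] <-]|_ [[u Uu <-] Vu]].
  by split; rewrite -fp //; exists (p a y).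
have [y yu] := almost_limit_surj limp u.
by exists y; rewrite -?fp ?yu//=; rewrite yu.
Qed.

End Rank.

Theorem proposition4p2 (d : Order.disp_t) (I : orderType d)
    (hI : is_cardinal I)
    (S : @inverse_system I (fun a b : I => (a < b)%O))
    (X : topologicalType) (p : forall a : I, X -> S a)
    (hS : forall a : I, tychonoff_space (S a))
    (hX : tychonoff_space X)
    (hcont : almost_continuous S)
    (hopen : forall (a b : I) (ab : (a < b)%O), nearly_open (@bond _ _ S a b ab))
    (hlim : almost_limit p) :
  basis [set U : set X | open U /\ finite_set (rank p U)]%classic.
Proof.
split=> [U []//|x N]; rewrite nbhsE => -[U [oU Ux] UN].
have [[a0]|noI] := pselect (inhabited I); last first.
  (* [X] embeds in the empty product, so it has at most one point. *)
  exists setT.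
    split=> //; split; first exact: openT.
    rewrite (_ : rank _ _ = set0)//; apply/seteqP; split=> // c _.
    by case: noI; exists.
  move=> y _; apply: UN; suff -> : y = x by [].
  have [[jinj _ _] _ _] := hlim; apply: jinj.
  by apply: functional_extensionality_dep => c; case: noI; exists.
have tot (a b : I) : [\/ a = b, (a < b)%O | (b < a)%O].
  by have [ab|ba|ab] := ltgtP a b; [exact: Or32|exact: Or33|exact: Or31].
have [a [V [oV Vx VU]]] := almost_limit_base hlim a0 tot oU Ux.
have [W [oW Wx WV fW]] := finite_rank_base hlim hopen hcont hI.1 oV Vx.
exists (p a @^-1` W); last by move=> y Wy; apply: UN; apply: VU; exact: WV.
split=> //; split=> //; apply: open_comp => // y _.
exact: almost_limit_continuous.
Qed.
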